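(* If $\Gamma$ is any abelian group and $G$ is a graph with $|\Gamma|$ vertices such that $G$ has two distinct vertices $u$ and $v$ with $|N_G(u)\cap N_G(v)|=\deg_G(u)-1=\deg_G(v)-1$, then $G$ is not $\Gamma$-distance magic.
   Context: All graphs are finite and simple; all groups are finite additive abelian groups. $N_G(u)$ is the set of vertices adjacent to $u$ in $G$, and $\deg_G(u)=|N_G(u)|$. For a graph $G$ and an abelian group $\Gamma$ with $|V(G)|=|\Gamma|$, a $\Gamma$-distance magic labeling of $G$ is a bijection $l:V(G)\to\Gamma$ for which there is an element $\mu_0\in\Gamma$ such that $w_G(u)=\sum_{v\in N_G(u)}l(v)=\mu_0$ for every $u\in V(G)$; $G$ is $\Gamma$-distance magic if it admits such a labeling. *)

(* Defs.v *)
From mathcomp Require Import all_boot all_order all_algebra.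

Set Implicit Arguments.
Unset Strict Implicit.
Unset Printing Implicit Defensive.

Import GRing.Theory.
Local Open Scope ring_scope.

Record sgraph := SGraph {
  vertex :> finType;
  adj : rel vertex;
  adj_sym : symmetric adj;
  adj_irrefl : irreflexive adj
}.

Definition neighbors (G : sgraph) (u : G) : {set G} := [set v | adj u v].

Definition degree (G : sgraph) (u : G) : nat := #|neighbors u|.

Definition weight (gT : finZmodType) (G : sgraph) (l : G -> gT) (u : G) : gT :=
  \sum_(v in neighbors u) l v.

Definition distance_magic_labeling (gT : finZmodType) (G : sgraph)
    (l : G -> gT) : Prop :=
  bijective l /\ exists mu0 : gT, forall u : G, weight l u = mu0.

Definition distance_magic (gT : finZmodType) (G : sgraph) : Prop :=
  exists l : G -> gT, distance_magic_labeling l.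

(* Main.v *)
Require Import Defs.
From mathcomp Require Import all_boot all_order all_algebra.
From mathcomp Require Import zify.

(* Each of N(u) and N(v) has exactly one element, a and b respectively, outside
   the other. Cancelling the labels on N(u) :&: N(v) in w(u) = w(v) gives
   l a = l b, so a = b by injectivity, which is absurd. *)

Import GRing.Theory.
Local Open Scope ring_scope.

(** [A] is the disjoint union of [A :&: B] and [A :\: B], so the hypothesis leaves exactly one
    element for the difference. *)
Lemma setD_singleton (T : finType) (A B : {set T}) :
  #|A :&: B|%:Z = #|A|%:Z - 1 -> exists a, A :\: B = [set a].
Proof.
move=> h; apply/cards1P; apply/eqP.
by have := cardsID B A; lia.
Qed.

(* The degrees are decremented in int: truncated subtraction on nat would let
   two isolated vertices satisfy the hypothesis. *)
Theorem lemma2p2 (gT : finZmodType) (G : sgraph) (hcard : #|G| = #|gT|)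
    (huv : exists u v : G,
        [/\ u <> v,
            #|neighbors u :&: neighbors v|%:Z = (degree u)%:Z - 1 &
            (degree u)%:Z - 1 = (degree v)%:Z - 1]) :
  ~ distance_magic gT G.
Proof.
move=> [l [/bij_inj l_inj [mu0 l_magic]]].
have [u [v [_ huv_u huv_uv]]] := huv.
have [a Da] := setD_singleton _ _ _ huv_u.
have [b Db] : exists b, neighbors v :\: neighbors u = [set b].
  by apply: setD_singleton; rewrite setIC huv_u huv_uv.
have : weight l u = weight l v by rewrite !l_magic.
rewrite /weight (big_setID (neighbors v)) Da big_set1 /=.
(* [setIC] makes the two sums over common neighbors identical, so that [addrI] can cancel them. *)
rewrite [RHS](big_setID (neighbors u)) Db big_set1 /= setIC.
move=> /addrI/l_inj ab.
(* The contradiction: [a] lies outside [neighbors v], whereas [b], now equal to [a], lies in it. *)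
have := set11 a; rewrite -Da inE => /andP[a_notin_v _].
by have := set11 b; rewrite -Db inE -ab (negPf a_notin_v) andbF.
Qed.
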